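(* Let $p$ be a prime number, let $C$ be a positive integer, and let $\varepsilon$ and $\kappa$ be positive real numbers with $\kappa<1$. Let $\{a_n\}_{n=1}^\infty$ and $\{b_n\}_{n=1}^\infty$ be sequences of non-zero integers with $p\nmid\gcd(a_n,b_n)$ such that $\limsup_{n\to\infty}\nu_p(a_n)=\infty$ and, whenever $m\ne n$, either $\nu_p(a_m)\neq\nu_p(a_n)$ or $\nu_p(a_m)=\nu_p(a_n)\le C$. Suppose that $a_{n+1}\ge a_n\ge n^{1+\varepsilon}$ and $|b_n|\le 2^{(\log_2|a_n|)^\kappa}$ for all sufficiently large $n$. Then the sequence $\{a_n/b_n\}$ is $p$-irrational if $\limsup_{n\to\infty}|a_n|^{1/2^n}=\infty$, and it is $p$-transcendental if $\limsup_{n\to\infty}a_n^{1/A^n}=\infty$ for every positive integer $A$.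
   Context: $\nu_p$ denotes the $p$-adic valuation. For a prime $p$, a sequence $\{x_n\}_{n=1}^\infty$ of non-zero numbers is called $p$-irrational (resp. $p$-transcendental) if for every sequence $\{c_n\}_{n=1}^\infty$ of integers with $p\nmid c_n$ for all $n$, the series $\sum_{n=1}^\infty\frac{1}{x_nc_n}$ converges to an irrational (resp. transcendental) number. (Here $x_n=a_n/b_n$, so the series is $\sum_n \frac{b_n}{a_nc_n}$.) *)

(* Defs.v *)
From HB Require Import structures.
From mathcomp Require Import all_boot all_order all_algebra.
From mathcomp Require Import all_classical all_reals all_analysis.
Set Implicit Arguments. Unset Strict Implicit. Unset Printing Implicit Defensive.
Import Order.TTheory GRing.Theory Num.Theory.
Import numFieldNormedType.Exports.
Local Open Scope ring_scope.

Definition nu (p : nat) (z : int) : nat := logn p `|z|%N.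

Definition irrational {R : realType} (x : R) : Prop := ~ exists q : rat, x = ratr q.

Definition transcendental {R : realType} (x : R) : Prop :=
  forall P : {poly rat}, P != 0 -> ~~ root (map_poly ratr P) x.

(* Sequences are indexed from 1: a n, b n for n >= 1 (index 0 unused).
   The term of the series for index n >= 1 is  b_n / (a_n c_n). *)
Definition pterm {R : realType} (a b c : nat -> int) : R ^nat :=
  fun k => (b k.+1)%:~R / ((a k.+1)%:~R * (c k.+1)%:~R).

Definition p_irrational (R : realType) (p : nat) (a b : nat -> int) : Prop :=
  forall c : nat -> int, (forall n, (0 < n)%N -> ~~ (p%:Z %| c n)%Z) ->
    cvgn (series (pterm (R := R) a b c)) /\ irrational (limn (series (pterm (R := R) a b c))).

Definition p_transcendental (R : realType) (p : nat) (a b : nat -> int) : Prop :=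
  forall c : nat -> int, (forall n, (0 < n)%N -> ~~ (p%:Z %| c n)%Z) ->
    cvgn (series (pterm (R := R) a b c)) /\ transcendental (limn (series (pterm (R := R) a b c))).

Definition log2 {R : realType} (x : R) : R := ln x / ln 2.

(* Main.v *)
Require Import Defs.
From HB Require Import structures.
From mathcomp Require Import all_boot all_order all_algebra.
From mathcomp Require Import all_classical all_reals all_analysis.
From mathcomp Require Import ring lra zify.
Import Order.TTheory GRing.Theory Num.Theory.
Import numFieldNormedType.Exports.
Local Open Scope ring_scope.

(** Discard the first terms, sort the others by increasing [d_i = |a_i c_i|] and
    let [S_n] be the sum of the [n] terms of smallest [d_i] and
    [Q_n = 2^(T_n)] the product of their [d_i].  Sorting preserves the growth
    hypotheses, since the sorted [d] dominates [a].  The growth condition with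
    base [A = D + 1] makes [Q_n^D |S - S_n|] arbitrarily small for infinitely
    many [n].  If [S] is a root of a nonzero rational polynomial [P] of degree
    at most [D], Liouville's argument then forces [P(S_n) = 0] for infinitely
    many [n].  But the p-adic valuation of [S_n] is minus the largest valuation
    among its denominators, which tends to minus infinity, so [S_n] eventually
    avoids every root of [P].  Irrationality is the case [D = 1]. *)

(** * Power estimates *)

Section PowerEstimates.
Variable R : realType.
Implicit Types (x y k del : R).

Lemma gt0_powRD x y z : 0 < x -> x `^ (y + z) = x `^ y * x `^ z.
Proof. by move=> x0; rewrite powRD// (gt_eqF x0) implybT. Qed.

Lemma powR_le_linear k del : k < 1 -> 0 < del ->
  exists2 x0, 1 <= x0 & forall x, x0 <= x -> x `^ k <= del * x.
Proof.
move=> k1 del0; have k1' : 0 < 1 - k by rewrite subr_gt0.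
(* Beyond 1, the threshold solves x^(k-1) = del. *)
exists (Num.max 1 (del `^ (- (1 - k)^-1))); first by rewrite le_max lexx.
move=> x; rewrite ge_max => /andP[x1 xd].
have x0 : 0 < x by apply: lt_le_trans x1.
have -> : x `^ k = x * x `^ (- (1 - k)).
  rewrite -[X in X * _]powRr1 ?(ltW x0)// -gt0_powRD//.
  by congr (_ `^ _); lra.
rewrite mulrC ler_wpM2r ?(ltW x0)// powRN.
rewrite -[leRHS]invrK lef_pV2 ?posrE ?invr_gt0// ?powR_gt0//.
have -> : del^-1 = (del `^ (- (1 - k)^-1)) `^ (1 - k).
  by rewrite -powRrM mulNr mulVf ?gt_eqF// powR_inv1// ltW.
by apply: ge0_ler_powR => //; rewrite ?nnegrE ?powR_ge0// ltW.
Qed.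

(** With t = x/y >= 1 the two sides are y^k (t^k - 1) and y (t - 1), compared factor by factor. Thus
    x - x^k is nondecreasing on [1, oo). *)
Lemma powR_sub_le k x y : 0 < k -> k <= 1 -> 1 <= y -> y <= x ->
  x `^ k - y `^ k <= x - y.
Proof.
move=> k0 k1 y1 yx; have y0 : 0 < y by apply: lt_le_trans y1.
have t1 : 1 <= x / y by rewrite ler_pdivlMr// mul1r.
have -> : x `^ k = y `^ k * (x / y) `^ k.
  rewrite -powRM ?(ltW y0)//; last by apply: le_trans t1.
  by rewrite mulrC divfK// gt_eqF.
have -> : x - y = y * (x / y - 1) by rewrite mulrBr mulr1 mulrC divfK// gt_eqF.
have -> : y `^ k * (x / y) `^ k - y `^ k = y `^ k * ((x / y) `^ k - 1) by ring.
apply: ler_pM; rewrite ?powR_ge0//.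
- by rewrite subr_ge0 -[X in X <= _](powRr0 (x / y)) ler_powR// ltW.
- exact: ler1_powR.
- by rewrite lerB// ler1_powR.
Qed.

(** With z = x^k', sublinearity gives x^k <= z/2 for large x, so the left side is at most 2^(-z/2).
    Since k' >= 1/2, z is at least the square root of x, and the degree 6 term of the exponential
    series already yields decay of order x^-3. *)
Lemma powR2_sub_le_sqr k k' eta : 0 < k -> k < k' -> 2^-1 <= k' -> 0 < eta ->
  exists2 x0, 1 <= x0 &
    forall x, x0 <= x -> (2 : R) `^ (x `^ k - x `^ k') <= eta / x ^+ 2.
Proof.
move=> k0 kk' k'2 eta0; have k'0 : 0 < k' by lra.
have [x1 x11 Hx1] : exists2 x0, 1 <= x0 &
    forall x, x0 <= x -> x `^ (k / k') <= 2^-1 * x.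
  by apply: powR_le_linear; rewrite ?ltr_pdivrMr ?mul1r// invr_gt0.
have c0 : 0 < ln 2 / 2 :> R by rewrite divr_gt0// ln_gt0// ltr1n.
set c := ln 2 / 2 in c0.
have [M M0 expM] : exists2 M : R, 0 < M &
    forall t : R, 0 <= t -> t ^+ 6 / M <= expR t.
  exists (6`!)%:R; first by rewrite ltr0n fact_gt0.
  by move=> t t0; apply: le_trans (expR_ge1Dxn 5 t0); rewrite lerDr.
set x2 := M / (c ^+ 6 * eta).
(* [x1 ^+ 2] puts the square root of x past [x1]; beyond [x2], the spare factor x in the decay x^-3
   absorbs all constants. *)
exists (Num.max (x1 ^+ 2) x2); first by rewrite le_max exprn_ege1.
move=> x; rewrite ge_max => /andP[xx1 xx2].
have x1le : 1 <= x by apply: le_trans xx1; rewrite exprn_ege1.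
have x0 : 0 < x by apply: lt_le_trans x1le.
set s := x `^ 2^-1.
have s2 : s ^+ 2 = x.
  by rewrite -powR_mulrn ?powR_ge0// -powRrM mulVf ?powRr1// ?pnatr_eq0// ltW.
have s1 : x1 <= s.
  rewrite -(@ler_pXn2r _ 2)// ?nnegrE ?powR_ge0//; first by rewrite s2.
  exact: le_trans x11.
have s0 : 0 < s by rewrite powR_gt0.
set z := x `^ k'.
have sz : s <= z by rewrite /s /z ler_powR.
have -> : x `^ k = z `^ (k / k').
  by rewrite -powRrM mulrC divfK// gt_eqF.
have Hz : z `^ (k / k') - z <= - (2^-1 * z).
  by have := Hx1 z (le_trans s1 sz); lra.
apply: (@le_trans _ _ (2 `^ (- (2^-1 * z)))); first by rewrite ler_powR// ler1n.
rewrite powRN.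
have -> : 2 `^ (2^-1 * z) = expR (c * z).
  by rewrite /powR pnatr_eq0/= /c; congr expR; field.
have Ht : (c * s) ^+ 6 / M <= expR (c * z).
  apply: (@le_trans _ _ (expR (c * s))); last by rewrite ler_expR ler_pM2l.
  by rewrite expM// ltW// mulr_gt0.
have Hp : 0 < (c * s) ^+ 6 / M by rewrite divr_gt0// exprn_gt0// mulr_gt0.
apply: (@le_trans _ _ ((c * s) ^+ 6 / M)^-1).
  by rewrite lef_pV2// posrE ?expR_gt0.
have -> : (c * s) ^+ 6 = c ^+ 6 * x ^+ 3.
  by rewrite -s2 -exprM exprMn.
have c6 : 0 < c ^+ 6 by rewrite exprn_gt0.
rewrite invf_div ler_pdivrMr; last by rewrite mulr_gt0// exprn_gt0.
have -> : eta / x ^+ 2 * (c ^+ 6 * x ^+ 3) = x * (c ^+ 6 * eta).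
  by field; rewrite gt_eqF.
rewrite -ler_pdivrMr//.
by rewrite mulr_gt0.
Qed.

(* Telescoping: k^-s - (k+1)^-s >= s (k+1)^-(1+s), from ln (1 - t) <= - t. *)
Lemma sum_powR_le s (n N : nat) : 0 < s ->
  \sum_(n <= k < N) (k.+1%:R : R) `^ (- (1 + s)) <= 1 + s^-1.
Proof.
move=> s0.
have step (m : nat) : (0 < m)%N -> (m.+1%:R : R) `^ (- (1 + s)) <=
    s^-1 * ((m%:R : R) `^ (- s) - m.+1%:R `^ (- s)).
  move=> m0.
  have M0 : 0 < (m.+1%:R : R) by rewrite ltr0n.
  have m0' : 0 < (m%:R : R) by rewrite ltr0n.
  rewrite ler_pdivlMl//.
  have -> : (m.+1%:R : R) `^ (- (1 + s)) = (m.+1%:R : R) `^ (- s) / m.+1%:R.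
    rewrite -[X in _ / X]powRr1 ?(ltW M0)// -powRN -gt0_powRD//.
    by congr (_ `^ _); lra.
  have -> : (m%:R : R) `^ (- s) = m.+1%:R `^ (- s) * (m%:R / m.+1%:R) `^ (- s).
    rewrite -powRM ?(ltW M0)// ?divr_ge0// ?(ltW M0)// mulrC divfK// gt_eqF//.
  rewrite -[X in _ <= _ - X]mulr1 -mulrBr mulrCA ler_wpM2l ?powR_ge0//.
  rewrite lerBrDl /powR gt_eqF ?divr_gt0//.
  apply: le_trans (expR_ge1Dx _) _; rewrite ler_expR.
  rewrite mulNr -mulrN ler_wpM2l ?(ltW s0)// lerNr.
  have -> : m%:R / m.+1%:R = 1 + (- m.+1%:R^-1) :> R.
    by rewrite -natr1; field; rewrite natr1 gt_eqF.
  apply: le_ln1Dx; rewrite ltrN2 invf_lt1// ltr1n ltnS//.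
have main : forall M : nat, \sum_(0 <= k < M.+1) (k.+1%:R : R) `^ (- (1 + s)) <=
    1 + s^-1 * (1 - M.+1%:R `^ (- s)).
  elim=> [|M IH]; first by rewrite big_nat1 powR1 subrr mulr0 addr0.
  rewrite big_nat_recr//=.
  apply: le_trans (lerD IH (step M.+1 isT)) _.
  by rewrite le_eqVlt; apply/orP; left; apply/eqP; ring.
have s0' : 0 < s^-1 by rewrite invr_gt0.
case: (leqP n N) => nN; last by rewrite big_geq ?(ltnW nN)// addr_ge0// ltW.
apply: (@le_trans _ _ (\sum_(0 <= k < N.+1) (k.+1%:R : R) `^ (- (1 + s)))).
  rewrite (@big_cat_nat _ _ _ n 0 N.+1)//= ?leqW// big_nat_recr//=.
  have h (u v : nat) : 0 <= \sum_(u <= k < v) (k.+1%:R : R) `^ (- (1 + s)).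
    by apply: sumr_ge0 => k _; rewrite powR_ge0.
  by have := h 0%N n; have := powR_ge0 (N.+1%:R : R) (- (1 + s)); lra.
apply: le_trans (main N) _.
by rewrite lerD2l ger_pMr// gerBl powR_ge0.
Qed.

End PowerEstimates.

(** * Tails infinitely often dominated by denominators *)

Lemma ex_last_nat (P : pred nat) (m r : nat) : (m < r)%N -> P m -> ~~ P r ->
  exists n, [/\ (m <= n < r)%N, P n & forall k, (n < k <= r)%N -> ~~ P k].
Proof.
move=> mr Pm NPr.
have exP : exists n, (P n && (n <= r)%N) by exists m; rewrite Pm ltnW.
have ubP n : P n && (n <= r)%N -> (n <= r)%N by case/andP.
have [n /andP[Pn nr] nmax] := ex_maxnP exP ubP.
exists n; split=> //.
  rewrite nmax ?Pm ?(ltnW mr)//= ltn_neqAle nr andbT.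
  by apply: contraNneq NPr => <-.
move=> k /andP[nk kr]; apply/negP => Pk.
by move: nk; rewrite ltnNge nmax// Pk.
Qed.

(** The factor 2 is there for m = 3, where 9 > 2^3. *)
Lemma sqrn_le_exp2 m : (m ^ 2 <= 2 * 2 ^ m)%N.
Proof.
case: m => [|[|[|m]]]//; elim: m => // m IH.
rewrite [in leqRHS]expnS; nia.
Qed.

Section Barrier.
Variable R : realType.

(** A purely geometric sequence satisfies w (n+1) = A w n with no room to spare. Taking w n = K (2
    A^n - s^n) with s = A^k < A gains K (A - s) s^n, of the same order as the bound (2K)^k s^(n+1)
    on w (n+1)^k; since k < 1, a large [K] wins. *)
Lemma ex_barrier (A k T0 : R) : 1 < A -> 0 < k -> k < 1 ->
  exists K : R, exists w : nat -> R, [/\ 2 <= K, T0 <= K,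
    forall n, K * A ^+ n <= w n <= 2 * K * A ^+ n &
    forall n, A * w n + w n.+1 `^ k <= w n.+1].
Proof.
move=> A1 k0 k1; have A0 : 0 < A by lra.
set s := A `^ k.
have s1 : 1 <= s by rewrite -(powRr0 A) ler_powR// ltW.
have sA : s < A.
  rewrite -[ltRHS]powRr1 ?ltW// /s /powR gt_eqF//= ltr_expR ltr_pM2r//.
  exact: ln_gt0.
(* At x = 2K this slope gives (2K)^k s <= K (A - s). *)
have [x0 x01 Hx0] := @powR_le_linear R k ((A - s) / (2 * s)) k1
  ltac:(by rewrite divr_gt0; lra).
pose K := Num.max x0 (Num.max 2 T0).
have Kx0 : x0 <= K by rewrite le_max lexx.
have K2 : 2 <= K by rewrite !le_max lexx orbT.
have KT : T0 <= K by rewrite !le_max lexx !orbT.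
exists K, (fun n => K * (2 * A ^+ n - s ^+ n)); split => //.
  move=> n.
  have sn : 0 <= s ^+ n by rewrite exprn_ge0//; lra.
  have snA : s ^+ n <= A ^+ n by rewrite lerXn2r ?nnegrE// ?ltW//; lra.
  by rewrite -mulrA [2 * (_ * _)]mulrCA !ler_pM2l; lra.
move=> n; set W := K * (2 * A ^+ n.+1 - s ^+ n.+1).
have sn : 0 <= s ^+ n.+1 by rewrite exprn_ge0//; lra.
have snA : s ^+ n.+1 <= A ^+ n.+1 by rewrite lerXn2r ?nnegrE// ?ltW//; lra.
have WK : W <= 2 * K * A ^+ n.+1.
  by rewrite /W [2 * K]mulrC -mulrA ler_pM2l; lra.
have Wk : W `^ k <= (2 * K) `^ k * s ^+ n.+1.
  have -> : s ^+ n.+1 = (A ^+ n.+1) `^ k.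
    rewrite /s -powR_mulrn ?powR_ge0// -powRrM mulrC powRrM powR_mulrn//.
    exact: ltW.
  rewrite -powRM ?exprn_ge0//; [|lra..].
  apply: ge0_ler_powR => //; rewrite ?nnegrE.
  - exact: ltW.
  - by apply: mulr_ge0; lra.
  - by apply: mulr_ge0; rewrite ?exprn_ge0//; lra.
have Hk : (2 * K) `^ k * s <= K * (A - s).
  have := Hx0 (2 * K) ltac:(lra).
  rewrite -(@ler_pM2r _ s); last by lra.
  move=> h; apply: le_trans h _.
  by rewrite le_eqVlt; apply/orP; left; apply/eqP; field; lra.
have s0 : 0 <= s ^+ n by rewrite exprn_ge0//; lra.
have := ler_wpM2r s0 Hk.
rewrite -mulrA -exprS => h.
have WE : W = A * (K * (2 * A ^+ n - s ^+ n)) + K * (A - s) * s ^+ n.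
  by rewrite /W !exprS; ring.
by rewrite [leRHS]WE lerD2l; apply: le_trans Wk h.
Qed.

End Barrier.

Section Tails.
Variables (R : realType) (k eps : R) (L : nat -> R).
Hypotheses (k_gt0 : 0 < k) (k_lt1 : k < 1) (eps_gt0 : 0 < eps).
Hypothesis L_homo : forall i j, (i <= j)%N -> L i <= L j.
Hypothesis L_ge : forall i : nat, (i.+1%:R : R) `^ (1 + eps) <= 2 `^ L i.

Lemma ler_powR2 (x y : R) : (2 `^ x <= 2 `^ y) = (x <= y).
Proof.
rewrite /powR pnatr_eq0/= ler_expR ler_pM2r// ln_gt0// ltr1n//.
Qed.

Lemma L_ge0 i : 0 <= L i.
Proof.
rewrite -ler_powR2 powRr0; apply: le_trans (L_ge i).
rewrite -[leLHS](powRr0 (i.+1%:R)); apply: ler_powR; first by rewrite ler1n.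
by rewrite addr_ge0// ltW.
Qed.

Lemma L_large x : exists m : nat, forall i, (m <= i)%N -> x <= L i.
Proof.
exists (Num.truncn (2 `^ x : R)) => i im; rewrite -ler_powR2.
apply: le_trans (L_ge i); apply: (@le_trans _ _ i.+1%:R).
  by apply/ltW/(lt_le_trans (truncnS_gt _)); rewrite ler_nat.
by apply: le1r_powR; rewrite ?ler1n// lerDl ltW.
Qed.

(** [L] stands for the base 2 logarithms of the denominators, so the summands bound terms of the
    series. For large j, L_j^k <= del L_j; a further del L_j >= del L_n pays for the factor on the
    right, and what remains of the exponent still gives a convergent sum. *)
Lemma tail_le_powR2 : exists del C0 : R, exists m : nat, [/\ 0 < del, 0 < C0 &
  forall n N, (m <= n)%N ->
    \sum_(n <= j < N) 2 `^ (L j `^ k - L j) <= C0 * 2 `^ (- (del * L n))].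
Proof.
(* Chosen so that 1 - 2 del = (1 + eps/2) / (1 + eps), which bounds 2^(-(1 - 2 del) L_j) by
   (j+1)^-(1 + eps/2). *)
pose del := eps / (4 * (1 + eps)).
have e0 := eps_gt0; have e1 : 0 < 1 + eps by lra.
have del0 : 0 < del by rewrite divr_gt0//; lra.
have [x0 x01 Hx0] := @powR_le_linear R k del k_lt1 del0.
have [m Hm] := L_large x0.
exists del, (1 + (eps / 2)^-1), m; split=> // [|n N mn].
  by rewrite addr_gt0// invr_gt0 divr_gt0.
have e2 : 0 < eps / 2 by lra.
rewrite mulrC.
have H2 := powR_ge0 2 (- (del * L n)).
have := ler_wpM2l H2 (@sum_powR_le R _ n N e2); apply: le_trans.
rewrite big_distrr/= big_nat [leRHS]big_nat; apply: ler_sum => j /andP[nj _].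
have Lj := Hx0 _ (Hm j (leq_trans mn nj)).
have Lnj := L_homo _ _ nj.
apply: (@le_trans _ _ (2 `^ (- (del * L n)) * 2 `^ (- ((1 - 2 * del) * L j)))).
  rewrite -gt0_powRD// ler_powR2.
  have : del * L n <= del * L j by rewrite ler_pM2l.
  by lra.
rewrite ler_wpM2l//.
have e3 : 1 - 2 * del = (1 + eps / 2) / (1 + eps).
  by rewrite /del; field; rewrite gt_eqF.
have e4 : 0 < 1 - 2 * del by rewrite e3 divr_gt0//; lra.
rewrite !powRN lef_pV2 ?posrE ?powR_gt0//.
have -> : 1 + eps / 2 = (1 + eps) * (1 - 2 * del).
  by rewrite e3; field; rewrite gt_eqF.
rewrite [X in _ <= 2 `^ X]mulrC !powRrM.
by apply: ge0_ler_powR; rewrite ?nnegrE ?powR_ge0// ltW.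
Qed.

Variable D : nat.
Hypothesis D_gt0 : (0 < D)%N.
Hypothesis L_limsup : forall (B : R) (N : nat),
  exists2 r, (N <= r)%N & B * D.+1%:R ^+ r < L r.

Let T n := \sum_(0 <= j < n) L j.

Lemma partial_sum_le j : T j.+1 <= j.+1%:R * L j.
Proof.
rewrite mulrC mulr_natr -[X in _ *+ X](subn0 j.+1) -sumr_const_nat.
by rewrite /T big_nat [leRHS]big_nat; apply: ler_sum => i /andP[_ ij]; exact: L_homo.
Qed.

(* [n] is the last index before a huge [L r] at which the partial sums [T]
   stay below a barrier [w] with [w (n+1) - w (n+1)^k' >= (D+1) w n].  Crossing
   the barrier at [n+1] makes [L n] exceed [D * T n] with room to spare, and
   staying above it up to [r] forces [L j >= j+1] there, so that the terms with
   [n <= j <= r] decay fast; those beyond [r] are dwarfed by [L r]. *)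
Lemma tail_small_infinitely_often (eta : R) (n0 : nat) : 0 < eta ->
  exists2 n, (n0 <= n)%N & forall N,
    2 `^ (D%:R * T n) * \sum_(n <= j < N) 2 `^ (L j `^ k - L j) <= eta.
Proof.
move=> eta0; have k0 := k_gt0; have k1 := k_lt1.
(* An exponent below 1 for the barrier, yet above [k] and at least 1/2 for the comparison of 2^(x^k
   - x^k') with inverse squares. *)
pose k' := (1 + k) / 2.
have k'0 : 0 < k' by rewrite /k'; lra.
have k'1 : k' < 1 by rewrite /k'; lra.
have [x0 x01 Hx0] := @powR2_sub_le_sqr R k k' (eta / 4) k_gt0
  ltac:(rewrite /k'; lra) ltac:(rewrite /k'; lra) ltac:(lra).
have [del [C0 [m1 [del0 C00 Htail]]]] := tail_le_powR2.
have [m2 Hm2] := L_large x0.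
pose nn := (maxn n0 (maxn m1 m2)).
pose A : R := D.+1%:R.
have A2 : 2 <= A by rewrite ler_nat.
have [K [w [K2 KT wb wrec]]] := @ex_barrier R A k' (T nn) ltac:(lra) k'0 k'1.
(* The first bound forces T (r+1) above the barrier. The second makes del L_r exceed D T_n by at
   least A^r whenever n <= r and T_n is below the barrier. *)
pose B := Num.max (2 * K * A) ((2 * D%:R * K + 1) / del).
have [r rnn Lr] := L_limsup B (maxn nn (Num.truncn (2 * C0 / eta)).+1).
have Anp n : 0 < A ^+ n by rewrite exprn_gt0//; lra.
have T0 n : 0 <= T n by apply: sumr_ge0 => j _; exact: L_ge0.
have Tnn : T nn <= w nn.
  apply: le_trans KT _; have /andP[h _] := wb nn; apply: le_trans h.
  by rewrite ler_peMr ?exprn_ege1//; lra.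
have TS n : T n.+1 = T n + L n by rewrite /T big_nat_recr.
have [nnr rC] : (nn <= r)%N /\ (Num.truncn (2 * C0 / eta) < r)%N.
  by apply/andP; rewrite -geq_max.
have Lr1 : 2 * K * A * A ^+ r < L r.
  by apply: le_lt_trans Lr; rewrite ler_pM2r// le_max lexx.
have Lr2 : (2 * D%:R * K + 1) / del * A ^+ r < L r.
  by apply: le_lt_trans Lr; rewrite ler_pM2r// le_max lexx orbT.
have Tr : ~~ (T r.+1 <= w r.+1).
  rewrite -ltNge; have /andP[_ h] := wb r.+1; apply: le_lt_trans h _.
  by rewrite TS exprS mulrA; have := T0 r; lra.
have [n [/andP[nnn nr] Tn nlast]] := @ex_last_nat (fun n => T n <= w n) nn r.+1
   nnr Tnn Tr.
have ge1 : forall j, (nn <= j)%N -> 1 <= L j.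
  move=> j nj; apply: le_trans x01 (Hm2 _ _).
  by apply: leq_trans nj; rewrite /nn !leq_max leqnn !orbT.
exists n; first by apply: leq_trans nnn; rewrite /nn leq_max leqnn.
(* As x - x^k' is nondecreasing, crossing the barrier gives T (n+1) - T (n+1)^k' >= w (n+1) - w
   (n+1)^k' >= (D+1) T n; subtract T n and use L n <= T (n+1). *)
have LT : D%:R * T n + L n `^ k' <= L n.
  have h1 : w n.+1 < T n.+1 by rewrite ltNge nlast// ltnSn.
  have w1 : 1 <= w n.+1.
    have /andP[h _] := wb n.+1; apply: le_trans h.
    have : 1 <= A ^+ n.+1 by rewrite exprn_ege1//; lra.
    by have := Anp n.+1; nra.
  have h2 := @powR_sub_le R k' _ _ k'0 (ltW k'1) w1 (ltW h1).
  have h3 := wrec n.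
  have h4 : A * T n <= A * w n by rewrite ler_pM2l//; lra.
  have h5 : L n `^ k' <= T n.+1 `^ k'.
    apply: ge0_ler_powR; rewrite ?nnegrE ?L_ge0// ?T0 ?(ltW k'0)//.
    by rewrite TS lerDr.
  move: h2 h4; rewrite TS /A -natr1 => h2 h4.
  rewrite TS in h5; lra.
(* Monotonicity of x - x^k' carries the gain from index n to j, so the total exponent is at most
   L_j^k - L_j^k'. *)
have near j : (n <= j <= r)%N ->
    2 `^ (D%:R * T n) * 2 `^ (L j `^ k - L j) <=
    eta / 4 * (j.+1%:R : R) `^ (- (1 + 1)).
  move=> /andP[nj jr].
  have Lnj := L_homo _ _ nj.
  (* Otherwise T (j+1) <= (j+1)^2 <= 2 * 2^(j+1) <= K A^(j+1), so the partial sum would be back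
     below the barrier after its last crossing. *)
  have Lj1 : j.+1%:R <= L j.
    rewrite leNgt; apply/negP => Ljlt.
    have : ~~ (T j.+1 <= w j.+1) by apply: nlast; rewrite ltnS nj ltnS.
    apply/negP; rewrite negbK.
    apply: le_trans (partial_sum_le j) _.
    apply: (@le_trans _ _ (2 * 2 ^+ j.+1)).
      apply: (@le_trans _ _ (j.+1%:R * j.+1%:R)); first by rewrite ler_pM2l ?ltr0n// ltW.
      rewrite -expr2 -!natrX -natrM ler_nat; exact: sqrn_le_exp2.
    have /andP[h _] := wb j.+1; apply: le_trans h.
    by apply: ler_pM => //; rewrite ?exprn_ge0// lerXn2r ?nnegrE//; lra.
  have h := @powR_sub_le R k' _ _ k'0 (ltW k'1) (ge1 n nnn) Lnj.
  apply: (@le_trans _ _ (2 `^ (L j `^ k - L j `^ k'))).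
    by rewrite -gt0_powRD// ler_powR2; lra.
  apply: le_trans (Hx0 (L j) _) _.
    apply: Hm2; rewrite (leq_trans _ nj)// (leq_trans _ nnn)//.
    by rewrite /nn !leq_max leqnn !orbT.
  rewrite ler_wpM2l//; first by lra.
  have -> : 1 + 1 = 2%:R :> R by rewrite -natr1.
  rewrite powRN powR_mulrn// lef_pV2 ?posrE ?exprn_gt0//.
    by rewrite lerXn2r ?nnegrE ?L_ge0.
  by apply: lt_le_trans Lj1.
have far N : 2 `^ (D%:R * T n) * \sum_(r.+1 <= j < N) 2 `^ (L j `^ k - L j) <= eta / 2.
  have rm1 : (m1 <= r.+1)%N.
    by apply: leqW; apply: leq_trans nnr; rewrite /nn !leq_max leqnn orbT.
  apply: le_trans (ler_wpM2l (powR_ge0 _ _) (Htail r.+1 N rm1)) _.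
  rewrite mulrCA -gt0_powRD//.
  have h1 : D%:R * T n <= 2 * D%:R * K * A ^+ r.
    have h : T n <= 2 * K * A ^+ r.
      apply: le_trans Tn _; have /andP[_ h] := wb n; apply: le_trans h _.
      rewrite ler_pM2l; last by lra.
      by rewrite ler_weXn2l//; lra.
    have := ler_wpM2l (ler0n R D) h; lra.
  have h2 : (2 * D%:R * K + 1) * A ^+ r <= del * L r.+1.
    have := L_homo _ _ (leqnSn r); move: Lr2.
    rewrite -mulrA mulrCA mulrC -ltr_pdivlMr ?invr_gt0// invrK.
    rewrite [del * L r.+1]mulrC => u v; apply: le_trans (ltW u) _.
    by rewrite ler_wpM2r// ltW.
  have h3 : D%:R * T n - del * L r.+1 <= - A ^+ r by lra.
  apply: (@le_trans _ _ (C0 * 2 `^ (- A ^+ r))).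
    by rewrite ler_pM2l// ler_powR2.
  rewrite powRN.
  (* This is where r was taken beyond 2 C0 / eta: r < (D+1)^r < 2^((D+1)^r). *)
  have h4 : 2 * C0 / eta <= 2 `^ (A ^+ r).
    apply: (@le_trans _ _ r%:R).
      by apply/ltW/(lt_le_trans (truncnS_gt _)); rewrite ler_nat.
    have -> : A ^+ r = (D.+1 ^ r)%:R by rewrite natrX.
    rewrite powR_mulrn// -natrX ler_nat.
    have a : (1 < D.+1)%N by rewrite ltnS.
    exact: leq_trans (ltnW (ltn_expl r a)) (ltnW (ltn_expl _ (ltnSn 1))).
  rewrite ler_pdivrMr ?powR_gt0//.
  rewrite ler_pdivrMr// in h4; lra.
(* Terms are nonnegative, so the range may be enlarged until it can be split at r + 1. *)
move=> N; pose N' := maxn N r.+1.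
apply: (@le_trans _ _ (2 `^ (D%:R * T n) * \sum_(n <= j < N') 2 `^ (L j `^ k - L j))).
  rewrite ler_wpM2l ?powR_ge0//.
  case: (leqP n N) => nN; last first.
    rewrite big_geq; last exact: ltnW.
    by apply: sumr_ge0 => j _; rewrite powR_ge0.
  rewrite (@big_cat_nat _ _ _ N n N')//= ?leq_maxl// lerDl.
  by apply: sumr_ge0 => j _; rewrite powR_ge0.
rewrite (@big_cat_nat _ _ _ r.+1 n N')//= ?leq_maxr//; last exact: ltnW.
rewrite mulrDr; have := far N'.
suff : 2 `^ (D%:R * T n) * \sum_(n <= j < r.+1) 2 `^ (L j `^ k - L j) <= eta / 2 by lra.
rewrite [leLHS]big_distrr/=.
apply: (@le_trans _ _ (eta / 4 * \sum_(n <= j < r.+1) (j.+1%:R : R) `^ (- (1 + 1)))).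
  rewrite [leRHS]big_distrr/= big_nat [leRHS]big_nat; apply: ler_sum => j /andP[nj jr].
  by apply: near; rewrite nj.
(* The inverse squares sum to at most 2, so the near part is at most eta / 2. *)
have := @sum_powR_le R 1 n r.+1 ltr01; rewrite invr1 => h.
by have := ler_wpM2l (_ : 0 <= eta / 4) h; lra.
Qed.

End Tails.

(** * Sorting and rearrangement *)

Section Sorting.
Variable d : nat -> nat.

(** Descent on the natural number [d i], starting from any index outside the finite list. *)
Lemma ex_argmin_notin (s : seq nat) :
  exists i, i \notin s /\ forall j, j \notin s -> (d i <= d j)%N.
Proof.
have [i0 i0s] : exists i, i \notin s.
  exists (\max_(x <- s) x).+1; apply/negP => xs.
  by have := @leq_bigmax_seq _ s predT id _ xs isT; rewrite ltnn.
have [m] := ubnP (d i0); elim: m i0 i0s => // m IH i iNs dm.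
have [h|] := pselect (exists j, j \notin s /\ (d j < d i)%N).
  by have [j [js jd]] := h; apply: (IH j js); apply: leq_trans jd _.
move=> h; exists i; split=> // j js; rewrite leqNgt; apply/negP => jd.
by apply: h; exists j.
Qed.

Definition argmin_notin s := projT1 (cid (ex_argmin_notin s)).

(** The recursion carries the whole list of indices already chosen, because the next choice has to
    avoid all of them. *)
Fixpoint sorted_prefix n : seq nat :=
  if n is m.+1 then rcons (sorted_prefix m) (argmin_notin (sorted_prefix m))
  else [::].

Definition sorting n := argmin_notin (sorted_prefix n).

Lemma sorted_prefixE n : sorted_prefix n = map sorting (iota 0 n).
Proof.
elim: n => // n IH.
by rewrite [LHS]/= -[argmin_notin _]/(sorting n) {1}IH -addn1 iotaD map_cat cats1.
Qed.

Lemma sorting_notin n : sorting n \notin sorted_prefix n.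
Proof. by rewrite /sorting /argmin_notin; case: cid => i []. Qed.

Lemma sorting_min n j : j \notin sorted_prefix n -> (d (sorting n) <= d j)%N.
Proof. by rewrite /sorting /argmin_notin; case: cid => i [] /= _; apply. Qed.

Lemma sorting_prefixP n i : reflect (exists2 j, (j < n)%N & i = sorting j)
  (i \in sorted_prefix n).
Proof.
rewrite sorted_prefixE; apply: (iffP mapP) => -[j jn ->]; exists j => //.
  by move: jn; rewrite mem_iota.
by rewrite mem_iota.
Qed.

Lemma sorting_inj : injective sorting.
Proof.
move=> i j; wlog ij : i j / (i < j)%N => [H|].
  case: (ltngtP i j) => // ij E; first exact: H.
  by apply/esym; apply: H.
move=> E; have := sorting_notin j; case/negP.
by apply/sorting_prefixP; exists i.
Qed.

Lemma sorting_homo i j : (i <= j)%N -> (d (sorting i) <= d (sorting j))%N.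
Proof.
move=> ij; apply: sorting_min; apply/negP => /sorting_prefixP[l li /sorting_inj E].
by move: li; rewrite -E ltnNge ij.
Qed.

(** Pigeonhole: n + 1 distinct indices cannot all lie below n. *)
Lemma sorting_ge n : exists2 i, (i <= n)%N & (n <= sorting i)%N.
Proof.
apply: contrapT => H.
have sub : {subset map sorting (iota 0 n.+1) <= iota 0 n}.
  move=> x /mapP[i]; rewrite mem_iota /= add0n => ilt ->.
  rewrite mem_iota /= add0n ltnNge; apply/negP => ni.
  by apply: H; exists i.
have := uniq_leq_size _ sub.
rewrite map_inj_uniq ?iota_uniq//; last exact: sorting_inj.
by rewrite size_map !size_iota ltnn => /(_ isT).
Qed.

(** Some i <= n has [sorting i] >= n, whence a n <= a (sorting i) <= d (sorting i) <= d (sorting n).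
    This transfers the growth of [a] to the sorted denominators. *)
Lemma le_sorting (a : nat -> nat) : (forall i j, (i <= j)%N -> (a i <= a j)%N) ->
  (forall i, (a i <= d i)%N) -> forall n, (a n <= d (sorting n))%N.
Proof.
move=> a_homo ad n; have [i iln ni] := sorting_ge n.
apply: leq_trans (sorting_homo i n iln).
exact: leq_trans (a_homo _ _ ni) (ad _).
Qed.

(** An index that is never chosen would bound every sorted value by its own. *)
Lemma sorting_surj : (forall v, exists n, (v < d (sorting n))%N) ->
  forall i, exists j, i = sorting j.
Proof.
move=> dinf i; have [n nd] := dinf (d i); apply: contrapT => H.
have := sorting_min n i _; rewrite leqNgt nd => /(_ _)/negP; apply => //.
by apply/negP => /sorting_prefixP[j _ E]; apply: H; exists j.
Qed.

End Sorting.

Section Rearrangement.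
Variables (R : realType) (x : nat -> R) (s : nat -> nat).
Hypothesis s_inj : injective s.
Hypothesis s_surj : forall i, exists j, i = s j.

(** A long enough partial sum in the original order contains the first n rearranged terms; its other
    terms sit at rearranged positions >= n, so [tau] bounds them. The limit preserves the bound. *)
Lemma rearranged_sum_near (n : nat) (tau : R) :
  (forall N, \sum_(n <= j < N) `|x (s j)| <= tau) ->
  cvgn (series x) -> `|limn (series x) - \sum_(0 <= j < n) x (s j)| <= tau.
Proof.
move=> Htau cv; set Sn := \sum_(0 <= j < n) x (s j).
have H : (\forall N \near \oo, (`|series x N - Sn| <= tau)%R)%classic.
  exists (\max_(0 <= j < n) (s j)).+1 => //= N /= HN.
  have lts j : (j < n)%N -> (s j < N)%N.
    move=> jn; apply: leq_trans HN; rewrite ltnS.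
    by apply: (@leq_bigmax_seq _ _ _ s) => //; rewrite mem_index_iota.
  pose pre := map s (iota 0 n).
  have upre : uniq pre by rewrite map_inj_uniq// iota_uniq.
  have -> : Sn = \sum_(i <- index_iota 0 N | i \in pre) x i.
    have -> : Sn = \sum_(i <- pre) x i by rewrite /Sn big_map /index_iota subn0.
    rewrite -[RHS]big_filter /index_iota subn0; apply: perm_big.
    apply: uniq_perm; rewrite ?filter_uniq ?iota_uniq//.
    move=> i; rewrite mem_filter mem_iota /= add0n.
    case: (boolP (i \in pre)) => //= /mapP[j]; rewrite mem_iota add0n /= => jn ->.
    by rewrite (lts _ jn).
  have -> : series x N - \sum_(i <- index_iota 0 N | i \in pre) x i =
     \sum_(i <- index_iota 0 N | i \notin pre) x i.
    by rewrite /series /= (bigID (fun i => i \in pre)) /= addrAC subrr add0r.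
  apply: le_trans (ler_norm_sum _ _ _) _.
  pose g i := projT1 (cid (s_surj i)).
  have gK i : s (g i) = i by rewrite /g; case: cid => j /= ->.
  pose r := [seq i <- index_iota 0 N | i \notin pre].
  (* Past the rearranged positions of all leftover indices. *)
  pose M := (\max_(i <- r) g i).+1.
  apply: le_trans (Htau M); rewrite -big_filter -/r.
  have -> : \sum_(i <- r) `|x i| = \sum_(j <- map g r) `|x (s j)|.
    by rewrite big_map; apply: eq_bigr => i _; rewrite gK.
  rewrite [leRHS](bigID (fun j => j \in map g r)) /=.
  rewrite -[X in X + _]big_filter.
  have -> : \sum_(j <- map g r) `|x (s j)| =
      \sum_(j <- [seq j <- index_iota n M | j \in map g r]) `|x (s j)|.
    apply: perm_big; apply: uniq_perm; rewrite ?filter_uniq ?iota_uniq//.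
      rewrite map_inj_in_uniq ?filter_uniq ?iota_uniq// => i j _ _ E.
      by rewrite -(gK i) -(gK j) E.
    move=> j; rewrite mem_filter mem_index_iota.
    case: (boolP (j \in map g r)) => //= /mapP[i ir ->].
    have gM : (g i < M)%N by rewrite ltnS; apply: leq_bigmax_seq.
    rewrite gM andbT; apply/esym; rewrite leqNgt; apply/negP => gn.
    move: ir; rewrite mem_filter => /andP[/negP]; case.
    by apply/mapP; exists (g i); rewrite ?gK// mem_iota.
  by rewrite lerDl sumr_ge0.
have cvS : (series x N - Sn @[N --> \oo] --> limn (series x) - Sn)%classic.
  by apply: cvgB => //; exact: cvg_cst.
rewrite -(cvg_lim (@Rhausdorff R) (cvg_norm cvS)).
by apply: limr_le => //; apply: cvgP (cvg_norm cvS).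
Qed.

End Rearrangement.

(** * Valuations of partial sums *)

Section PadicSums.
Variables (p : nat) (p_prime : prime p).

Lemma prime_dvdzM (m n : int) :
  (p%:Z %| m * n)%Z = (p%:Z %| m)%Z || (p%:Z %| n)%Z.
Proof. by rewrite !dvdzE abszM Euclid_dvdM. Qed.

Lemma nu_factor (z : int) : z != 0 ->
  exists2 m : int, z = p%:Z ^+ nu p z * m & ~~ (p%:Z %| m)%Z.
Proof.
move=> z0; have z0' : (0 < `|z|)%N by rewrite absz_gt0.
have : (p%:Z ^+ nu p z %| z)%Z by rewrite dvdzE abszX pfactor_dvdn.
move/dvdzP => [q zE]; exists q; first by rewrite mulrC.
apply/negP => /dvdzP[r qE].
have : (p ^ (nu p z).+1 %| `|z|)%N.
  by rewrite [in X in (_ %| X)%N]zE qE -mulrA -exprS abszM abszX dvdn_mull.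
by rewrite pfactor_dvdn// ltnn.
Qed.

Lemma nuM_coprime (x y : int) : x != 0 -> ~~ (p%:Z %| y)%Z ->
  nu p (x * y) = nu p x.
Proof.
move=> x0 py; have y0 : y != 0 by apply: contraNneq py => ->; rewrite dvdz0.
rewrite /nu abszM lognM ?absz_gt0//; rewrite dvdzE in py.
rewrite [X in (_ + X)%N](_ : _ = 0%N) ?addn0//; apply/eqP.
by rewrite lognE p_prime absz_gt0 y0 (negPf py).
Qed.

(** The localization of the integers at [p]; an explicit multiplier avoids working with reduced
    fractions. *)
Definition p_integral (x : rat) :=
  exists2 w : int, ~~ (p%:Z %| w)%Z & exists z : int, w%:~R * x = z%:~R.

Lemma p_integralB x y : p_integral x -> p_integral y -> p_integral (x - y).
Proof.
move=> [w pw [z wz]] [w' pw' [z' wz']]; exists (w * w').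
  by rewrite prime_dvdzM negb_or pw.
exists (w' * z - w * z'); rewrite rmorphB !rmorphM/= -wz -wz'; ring.
Qed.

Lemma p_integral0 : p_integral 0.
Proof.
exists 1; last by exists 0; rewrite mulr0.
by rewrite dvdzE /= dvdn1 neq_ltn prime_gt1 ?orbT.
Qed.

Lemma p_integral_sum (I : Type) (r : seq I) (P : pred I) (F : I -> rat) :
  (forall i, P i -> p_integral (F i)) -> p_integral (\sum_(i <- r | P i) F i).
Proof.
move=> PF; elim/big_ind: _ => [||//]; first exact: p_integral0.
move=> x y px py; rewrite -[y]opprK -[- y]sub0r.
by apply: p_integralB => //; apply: p_integralB => //; exact: p_integral0.
Qed.

Lemma p_integral_frac (e : nat) (u v : int) : v != 0 -> (nu p v <= e)%N ->
  p_integral (p%:R ^+ e * (u%:~R / v%:~R)).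
Proof.
move=> v0 ve; have [m vE pm] := nu_factor v v0.
have m0 : m != 0 by apply: contraNneq pm => ->; rewrite dvdz0.
exists m => //; exists (p%:Z ^+ (e - nu p v) * u).
have p0 : (p%:R : rat) != 0 by rewrite pnatr_eq0 -lt0n prime_gt0.
rewrite [in v%:~R]vE !rmorphM /= !rmorphXn /= -{1}(subnK ve) exprD -!pmulrn.
by field; rewrite intr_eq0 m0 expf_neq0.
Qed.

(** Writing v = p^(e+1) m, a multiplier w would give w u = p m z, although p divides neither w nor
    u. *)
Lemma not_p_integral_frac (e : nat) (u v : int) : v != 0 -> nu p v = e.+1 ->
  ~~ (p%:Z %| u)%Z -> ~ p_integral (p%:R ^+ e * (u%:~R / v%:~R)).
Proof.
move=> v0 ve pu [w pw [z wz]]; have [m vE pm] := nu_factor v v0.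
have m0 : m != 0 by apply: contraNneq pm => ->; rewrite dvdz0.
have p0 : (p%:R : rat) != 0 by rewrite pnatr_eq0 -lt0n prime_gt0.
suff E : w * u = p%:Z * (m * z).
  have : (p%:Z %| w * u)%Z by rewrite E dvdz_mulr.
  by rewrite prime_dvdzM (negPf pw) (negPf pu).
apply: (@intr_inj rat); rewrite !rmorphM /= -wz vE ve !rmorphM /= !rmorphXn /=.
rewrite -!pmulrn exprS; field.
by rewrite intr_eq0 m0 p0 expf_neq0.
Qed.

Variables (C : nat) (be de : nat -> int).
Hypothesis de_neq0 : forall j, de j != 0.
Hypothesis be_ndiv : forall j, (0 < nu p (de j))%N -> ~~ (p%:Z %| be j)%Z.
Hypothesis nu_distinct : forall i j, i <> j ->
  nu p (de i) <> nu p (de j) \/ (nu p (de i) <= C)%N.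
Hypothesis nu_unbounded : forall M, exists n, (M <= nu p (de n))%N.

(* Once a valuation above [C] has occurred, the largest valuation of a
   denominator is attained exactly once, so it is that of the partial sum. *)
Lemma partial_sum_neq (rho : rat) : exists n1, forall n, (n1 <= n)%N ->
  \sum_(0 <= j < n) ((be j)%:~R / (de j)%:~R) != rho.
Proof.
(* Exceeding the valuation of the denominator of [rho] as well makes p^e [rho] integral below. *)
have [n1 Hn1] := nu_unbounded (maxn C (nu p (denq rho))).+1.
exists n1.+1 => n n1n; apply/negP => /eqP Srho.
pose i1 : 'I_n := Ordinal n1n.
have [i _ imax] := @arg_maxnP _ i1 predT (fun i => nu p (de i)) isT.
have : (maxn C (nu p (denq rho)) < nu p (de i))%N.
  by apply: leq_trans Hn1 (imax i1 isT).
case Ee: (nu p (de i)) => [//|e]; rewrite ltnS geq_max => /andP[Ce nue].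
apply: (@not_p_integral_frac e (be i) (de i)) => //; first by apply: be_ndiv; rewrite Ee.
(* The scaling is one power short of the top valuation e + 1: [rho] and the other terms become
   integral, the [i]-th does not. *)
have -> : p%:R ^+ e * ((be i)%:~R / (de i)%:~R) = p%:R ^+ e * rho -
    \sum_(j < n | j != i) p%:R ^+ e * ((be j)%:~R / (de j)%:~R) :> rat.
  by rewrite -Srho big_mkord (bigD1 i)//= mulrDr big_distrr/= addrK.
apply: p_integralB.
  rewrite -[rho]divq_num_den; apply: p_integral_frac => //.
apply: p_integral_sum => j ji; apply: p_integral_frac => //.
have : (nu p (de j) <= e.+1)%N by rewrite -Ee; exact: imax j isT.
rewrite leq_eqVlt => /orP[/eqP E|//].
have ij : val i <> val j by move=> /val_inj E'; move: ji; rewrite E' eqxx.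
have [|] := nu_distinct _ _ ij; first by rewrite Ee E.
by rewrite Ee leqNgt ltnS Ce.
Qed.

End PadicSums.

(** Roots in [F] are split off one linear factor at a time, and [u] eventually avoids each. *)
Lemma eventually_not_root (F : fieldType) (u : nat -> F) (P : {poly F}) :
  (forall rho, exists n1, forall n, (n1 <= n)%N -> u n != rho) -> P != 0 ->
  exists n1, forall n, (n1 <= n)%N -> ~~ root P (u n).
Proof.
move=> Hu; have [m] := ubnP (size P); elim: m P => // m IH P sP P0.
have [[rho rP]|nP] := pselect (exists rho, root P rho); last first.
  by exists 0%N => n _; apply/negP => rn; apply: nP; exists (u n).
move/factor_theorem: rP => [Q PE].
have Q0 : Q != 0 by apply: contraNneq P0 => Q0; rewrite PE Q0 mul0r.
have sQ : (size Q < m)%N.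
  by move: sP; rewrite PE size_Mmonic ?monicXsubC// size_XsubC addn2/= ltnS.
have [n1 H1] := IH Q sQ Q0; have [n2 H2] := Hu rho.
exists (maxn n1 n2) => n; rewrite geq_max => /andP[h1 h2].
by rewrite PE rootM negb_or H1// root_XsubC H2.
Qed.

(** * Liouville's inequality *)

Section Liouville.
Variable R : realType.

Lemma horner_norm_le (G : {poly R}) (x M : R) : `|x| <= M ->
  `|G.[x]| <= \sum_(i < size G) `|G`_i| * M ^+ i.
Proof.
move=> xM; rewrite horner_coef; apply: le_trans (ler_norm_sum _ _ _) _.
apply: ler_sum => i _; rewrite normrM normrX ler_wpM2l// lerXn2r ?nnegrE//.
exact: le_trans xM.
Qed.

Lemma int_horner_denominator (P : {poly int}) (D : nat) (q : rat) (Q u : int) :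
  (size P <= D.+1)%N -> Q%:~R * q = u%:~R ->
  exists z : int, Q%:~R ^+ D * (map_poly intr P).[q] = z%:~R.
Proof.
move=> sP Qq; exists (\sum_(i < D.+1) P`_i * u ^+ i * Q ^+ (D - i)).
rewrite (@horner_coef_wide _ D.+1); last first.
  by apply: leq_trans sP; rewrite size_poly.
rewrite big_distrr rmorph_sum /=; apply: eq_bigr => i _.
rewrite coef_map /= !rmorphM !rmorphXn /= -Qq exprMn.
have iD : (i <= D)%N by rewrite -ltnS.
rewrite -{1}(subnKC iD) exprD; ring.
Qed.

(** Factor P = G (X - S). Clearing denominators turns P(q) into a nonzero integer, of absolute value
    at least 1, while G is bounded within distance 1 of S. *)
Lemma liouville (P : {poly rat}) (D : nat) (S : R) :
  P != 0 -> (size P <= D.+1)%N -> root (map_poly ratr P) S ->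
  exists2 E : R, 0 < E & forall (q : rat) (Q u : int), Q != 0 ->
    Q%:~R * q = u%:~R -> ~~ root P q -> `|S - ratr q| <= 1 ->
    1 <= E * `|Q%:~R| ^+ D * `|S - ratr q|.
Proof.
move=> P0 sP /factor_theorem[G PE].
have [P' [a a0 PaE]] := rat_poly_scale P.
pose M := \sum_(i < size G) `|G`_i| * (`|S| + 1) ^+ i.
have M0 : 0 <= M by apply: sumr_ge0 => i _; rewrite mulr_ge0// exprn_ge0// addr_ge0.
have sP' : (size P' <= D.+1)%N.
  move: sP; rewrite PaE size_scale ?invr_eq0 ?intr_eq0//.
  rewrite size_map_poly_id0// intr_eq0 lead_coef_eq0.
  by apply: contraNneq P0 => E; rewrite PaE E rmorph0 scaler0.
(* [M] may vanish; adding 1 keeps the constant positive. *)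
exists (`|a%:~R| * (M + 1)).
  by rewrite mulr_gt0 ?normr_gt0 ?intr_eq0// ltr_wpDl.
move=> q Q u Q0 Qq nrP Sq.
have [z zE] := int_horner_denominator P' D q Q u sP' Qq.
have Pq : (map_poly intr P').[q] = a%:~R * P.[q].
  by rewrite PaE hornerZ mulrA divff ?mul1r// intr_eq0.
have z0 : z != 0.
  rewrite -(intr_eq0 rat) -zE Pq !mulf_neq0// ?expf_neq0 ?intr_eq0//.
have z1 : 1 <= `|(z%:~R : R)| by rewrite -intr_norm -[1]/(1%:~R) ler_int; lia.
have zR : (z%:~R : R) = Q%:~R ^+ D * (a%:~R * (G.[ratr q] * (ratr q - S))).
  have -> : (z%:~R : R) = ratr (z%:~R) by rewrite ratr_int.
  rewrite -zE Pq !rmorphM rmorphXn /= !ratr_int.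
  by rewrite -horner_map /= PE hornerM hornerXsubC.
have GM : `|G.[ratr q]| <= M.
  apply: horner_norm_le.
  have -> : ratr q = S - (S - ratr q) by ring.
  by apply: le_trans (ler_normB _ _) _; rewrite lerD2l.
apply: le_trans z1 _; rewrite zR !normrM normrX [`|ratr q - S|]distrC.
set v := `|S - ratr q|; set b := `|Q%:~R| ^+ D; set c := `|a%:~R|.
have -> : c * (M + 1) * b * v = b * (c * ((M + 1) * v)) by ring.
apply: ler_wpM2l; first by rewrite exprn_ge0.
apply: ler_wpM2l; first exact: normr_ge0.
apply: ler_wpM2r; first exact: normr_ge0.
by apply: le_trans GM _; rewrite lerDl.
Qed.

End Liouville.

(** * The sorted series *)

Section Log2.
Variable R : realType.

Lemma ln2_gt0 : 0 < ln (2 : R).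
Proof. by rewrite ln_gt0// ltr1n. Qed.

Lemma powR2_log2 (x : R) : 0 < x -> 2 `^ log2 x = x.
Proof.
move=> x0; rewrite /powR pnatr_eq0/= /log2 divfK ?gt_eqF ?ln2_gt0//.
exact: lnK.
Qed.

Lemma ler_log2 (x y : R) : 0 < x -> x <= y -> log2 x <= log2 y.
Proof.
move=> x0 xy; rewrite /log2 ler_pM2r ?invr_gt0 ?ln2_gt0// ler_ln ?posrE//.
exact: lt_le_trans xy.
Qed.

Lemma log2_ge0 (x : R) : 1 <= x -> 0 <= log2 x.
Proof. by move=> x1; apply: divr_ge0; [exact: ln_ge0|exact/ltW/ln2_gt0]. Qed.

Lemma log2_gt_of_root (x B y : R) : 0 < x -> 0 < y ->
  2 `^ B < x `^ y^-1 -> B * y < log2 x.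
Proof.
move=> x0 y0; rewrite /powR pnatr_eq0 (gt_eqF x0)/= ltr_expR ltr_pdivlMl// => h.
by rewrite /log2 ltr_pdivlMr ?ln2_gt0// mulrAC mulrC.
Qed.

End Log2.

Section SeriesOfFractions.
Variables (R : realType) (p C : nat) (eps kappa : R) (a b c : nat -> int).
Hypotheses (p_prime : prime p) (eps_gt0 : 0 < eps).
Hypotheses (kappa_gt0 : 0 < kappa) (kappa_lt1 : kappa < 1).
Hypothesis a_homo : forall i, a i <= a i.+1.
Hypothesis a_ge : forall i, (i.+1%:R : R) `^ (1 + eps) <= (a i)%:~R.
Hypothesis b_le : forall i,
  `|(b i)%:~R| <= (2 : R) `^ ((log2 ((a i)%:~R : R)) `^ kappa).
Hypothesis b_ndiv : forall i, (0 < nu p (a i))%N -> ~~ (p%:Z %| b i)%Z.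
Hypothesis nu_distinct : forall i j, i <> j ->
  nu p (a i) <> nu p (a j) \/ (nu p (a i) <= C)%N.
Hypothesis nu_unbounded : forall M, exists n, (M <= nu p (a n))%N.
Hypothesis c_ndiv : forall i, ~~ (p%:Z %| c i)%Z.

Let x (i : nat) : R := (b i)%:~R / ((a i)%:~R * (c i)%:~R).

Lemma c_neq0 i : c i != 0.
Proof. by apply: contraNneq (c_ndiv i) => ->; rewrite dvdz0. Qed.

Lemma a_geS i : (i.+1%:R : R) <= (a i)%:~R.
Proof.
by apply: le_trans (a_ge i); apply: le1r_powR; rewrite ?ler1n// lerDl ltW.
Qed.

Lemma a_gt0 i : 0 < a i.
Proof. by rewrite -(ltr0z R); apply: lt_le_trans (a_geS i); rewrite ltr0n. Qed.

Lemma a_le i j : (i <= j)%N -> a i <= a j.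
Proof.
elim: j => [|j IH]; first by rewrite leqn0 => /eqP ->.
by rewrite leq_eqVlt => /orP[/eqP->//|ij]; apply: le_trans (IH _) (a_homo j).
Qed.

Let d i := absz (a i * c i).

Lemma a_le_d i : (absz (a i) <= d i)%N.
Proof. by rewrite /d abszM leq_pmulr// absz_gt0 c_neq0. Qed.

Lemma a_absz i : ((absz (a i))%:R : R) = (a i)%:~R.
Proof. by rewrite natr_absz gtr0_norm ?a_gt0. Qed.

(** Since |c_i| >= 1, [d i] dominates [a i], so the bound on the numerator survives with [d i] in
    place of [a i]. The terms are thus controlled by the quantity they are sorted by. *)
Lemma term_le i : `|x i| <= 2 `^ (log2 (d i)%:R `^ kappa - log2 (d i)%:R).
Proof.
have ad : (a i)%:~R <= (d i)%:R :> R by rewrite -a_absz ler_nat a_le_d.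
have ai := a_gt0 i.
have a1 : 1 <= (a i)%:~R :> R by rewrite -[1]/(1%:~R) ler_int.
have d0 : 0 < (d i)%:R :> R by apply: lt_le_trans ad; rewrite ltr0z.
rewrite gt0_powRD// powRN powR2_log2//.
have -> : `|x i| = `|(b i)%:~R| / (d i)%:R.
  by rewrite /x -intrM normrM normfV -!intr_norm natr_absz.
apply: ler_wpM2r; first by rewrite invr_ge0.
apply: le_trans (b_le i) _.
rewrite ler_powR2; apply: ge0_ler_powR; rewrite ?nnegrE ?log2_ge0// ?(ltW kappa_gt0)//.
  exact: le_trans ad.
by apply: ler_log2 => //; rewrite ltr0z.
Qed.

Lemma log2_a_ge i : (i.+1%:R : R) `^ (1 + eps) <= 2 `^ log2 (a i)%:~R.
Proof. by rewrite powR2_log2// ltr0z a_gt0. Qed.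

Lemma log2_a_le i j : (i <= j)%N -> log2 (a i)%:~R <= log2 (a j)%:~R :> R.
Proof. by move=> ij; apply: ler_log2; rewrite ?ltr0z ?a_gt0// ler_int a_le. Qed.

Lemma cvg_series_frac : cvgn (series x).
Proof.
apply: normed_cvg.
have xle i : `|x i| <= 2 `^ (log2 (a i)%:~R `^ kappa - log2 (a i)%:~R).
  have a0 := a_gt0 i.
  rewrite gt0_powRD// powRN powR2_log2 ?ltr0z//.
  rewrite /x normrM normfV.
  apply: ler_pM; rewrite ?invr_ge0// lef_pV2 ?posrE ?ltr0z//.
    rewrite normrM [`|(a i)%:~R|]gtr0_norm ?ltr0z// ler_peMr ?ler0z ?(ltW a0)//.
    rewrite -intr_norm -[1]/(1%:~R) ler_int.
    by rewrite -gtz0_ge1 normr_gt0 c_neq0.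
  by rewrite normr_gt0 -intrM intr_eq0 mulf_neq0 ?c_neq0// gt_eqF.
(* [a] is already monotone, so the tail bound gives absolute convergence without sorting. *)
have [del [C0 [m [del0 C00 H]]]] :=
  tail_le_powR2 R kappa eps _ kappa_lt1 eps_gt0 log2_a_le log2_a_ge.
apply: nondecreasing_is_cvgn.
  apply/nondecreasing_seqP => n; rewrite -subr_ge0 seriesSB.
  exact: normr_ge0.
pose B := \sum_(0 <= i < m) `|x i| + C0 * 2 `^ (- (del * log2 (a m)%:~R)).
exists B => _ [n _ <-]; change (\sum_(0 <= i < n) `|x i| <= B).
have h N : \sum_(m <= i < N) `|x i| <= C0 * 2 `^ (- (del * log2 (a m)%:~R)).
  by apply: le_trans (H m N (leqnn m)); apply: ler_sum.
case: (leqP m n) => mn; first by rewrite (@big_cat_nat _ _ _ m)//= lerD2l h.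
have p0 : 0 <= C0 * 2 `^ (- (del * log2 (a m)%:~R)).
  by rewrite mulr_ge0 ?powR_ge0// ltW.
rewrite /B (@big_cat_nat _ _ _ n 0 m)//=; last exact: ltnW.
by rewrite -addrA lerDl addr_ge0// sumr_ge0.
Qed.

Let s := sorting d.
Let L j : R := log2 (d (s j))%:R.

Lemma a_le_d_sorted j : ((a j)%:~R : R) <= (d (s j))%:R.
Proof.
rewrite -a_absz ler_nat; apply: (@le_sorting d (fun i => absz (a i))).
  by move=> i k ik; rewrite -lez_nat !gtz0_abs ?a_gt0// a_le.
exact: a_le_d.
Qed.

Lemma d_sorted_gt0 j : 0 < (d (s j))%:R :> R.
Proof. by apply: lt_le_trans (a_le_d_sorted j); rewrite ltr0z a_gt0. Qed.

Lemma s_surj i : exists j, i = s j.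
Proof.
apply: sorting_surj => v; exists v; rewrite -(ltr_nat R).
apply: lt_le_trans (a_le_d_sorted v); apply: lt_le_trans (a_geS v).
by rewrite ltr_nat.
Qed.

Variable D : nat.
Hypothesis D_gt0 : (0 < D)%N.
Hypothesis a_limsup : forall (B : R) (N : nat),
  exists2 r, (N <= r)%N & B * D.+1%:R ^+ r < log2 (a r)%:~R.

Let de j := a (s j) * c (s j).
Let be j := b (s j).
Let q n : rat := \sum_(0 <= j < n) ((be j)%:~R / (de j)%:~R).

Lemma partial_sum_denominator n : exists u : int,
  (\prod_(0 <= j < n) de j)%:~R * q n = u%:~R.
Proof.
have de0 j : de j != 0 by rewrite mulf_neq0 ?c_neq0// gt_eqF ?a_gt0.
elim: n => [|n [u IH]]; first by exists 0; rewrite /q !big_nil mulr0.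
exists (de n * u + \prod_(0 <= j < n) de j * be n).
rewrite /q !big_nat_recr//= -/(q n); move: (de n) (de0 n) IH => e e0.
move: (\prod_(0 <= j < n) de j) (q n) (be n) => Q r v IH.
by rewrite rmorphD !rmorphM /= -IH; field; rewrite intr_eq0.
Qed.

Lemma norm_denominator n :
  `|(\prod_(0 <= j < n) de j)%:~R| = 2 `^ (\sum_(0 <= j < n) L j) :> R.
Proof.
elim: n => [|n IH]; first by rewrite !big_nil powRr0 normr1.
rewrite !big_nat_recr//= intrM normrM IH gt0_powRD//; congr (_ * _).
by rewrite powR2_log2 ?d_sorted_gt0// -intr_norm natr_absz.
Qed.

(** Growth with base D + 1 handles polynomials of degree at most D: at a well chosen n, Liouville's
    lower bound 1 contradicts an upper bound 1/2. *)
Lemma limit_not_root (P : {poly rat}) : P != 0 -> (size P <= D.+1)%N ->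
  ~~ root (map_poly ratr P) (limn (series x)).
Proof.
move=> P0 sP; apply/negP => rP.
have [E E0 HE] := liouville R P D _ P0 sP rP.
have de0 j : de j != 0 by rewrite mulf_neq0 ?c_neq0// gt_eqF ?a_gt0.
have nude j : nu p (de j) = nu p (a (s j)).
  by rewrite nuM_coprime ?c_ndiv// gt_eqF ?a_gt0.
have qneq rho : exists n1, forall n, (n1 <= n)%N -> q n != rho.
  apply: (@partial_sum_neq p p_prime C be de) => //.
  - by move=> j; rewrite nude; apply: b_ndiv.
  - move=> i j ij; rewrite !nude; apply: nu_distinct => E'.
    by apply: ij; apply: (@sorting_inj d).
  - move=> M; have [i iM] := nu_unbounded M; have [j ij] := s_surj i.
    by exists j; rewrite nude -ij.
have [n1 Hn1] := eventually_not_root _ q P qneq P0.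
have L_homo i j : (i <= j)%N -> L i <= L j.
  by move=> ij; apply: ler_log2; rewrite ?d_sorted_gt0// ler_nat sorting_homo.
have L_ge i : (i.+1%:R : R) `^ (1 + eps) <= 2 `^ L i.
  rewrite powR2_log2 ?d_sorted_gt0//; exact: le_trans (a_ge i) (a_le_d_sorted i).
have L_limsup (B : R) N : exists2 r, (N <= r)%N & B * D.+1%:R ^+ r < L r.
  have [r Nr Br] := a_limsup B N; exists r => //; apply: lt_le_trans Br _.
  by apply: ler_log2; rewrite ?ltr0z ?a_gt0// a_le_d_sorted.
(* The 1 keeps [q n] within distance 1 of the limit, as Liouville's inequality requires; the other
   entry makes E eta <= 1/2. *)
pose eta := Num.min 1 (2 * E)^-1.
have eta0 : 0 < eta by rewrite lt_min ltr01 invr_gt0 mulr_gt0.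
have [n n1n Hn] := tail_small_infinitely_often R kappa eps L kappa_gt0 kappa_lt1
  eps_gt0 L_homo L_ge D D_gt0 L_limsup eta n1 eta0.
set T := \sum_(0 <= j < n) L j in Hn.
pose W : R := 2 `^ (D%:R * T).
have W0 : 0 < W by rewrite powR_gt0.
have W1 : 1 <= W.
  rewrite -(powRr0 2) ler_powR2 mulr_ge0// sumr_ge0// => j _.
  exact: (L_ge0 R eps L).
have near : `|limn (series x) - \sum_(0 <= j < n) x (s j)| <= eta / W.
  apply: rearranged_sum_near cvg_series_frac; [exact: sorting_inj|exact: s_surj|].
  move=> N; rewrite ler_pdivlMr// mulrC; apply: le_trans (Hn N).
  by rewrite ler_pM2l//; apply: ler_sum => j _; exact: term_le.
have qE : ratr (q n) = \sum_(0 <= j < n) x (s j).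
  rewrite /q rmorph_sum /=; apply: eq_bigr => j _.
  by rewrite fmorph_div /= !ratr_int intrM.
rewrite -qE in near.
have [u uE] := partial_sum_denominator n.
have Q0 : \prod_(0 <= j < n) de j != 0.
  by rewrite prodf_seq_neq0; apply/allP => j _; exact: de0.
have near1 : eta / W <= 1.
  rewrite ler_pdivrMr// mul1r; apply: le_trans W1.
  by rewrite ge_min lexx.
have := HE _ _ _ Q0 uE (Hn1 n n1n) (le_trans near near1).
rewrite norm_denominator -/T -powR_mulrn ?powR_ge0// -powRrM [T * _]mulrC -/W.
apply/negP; rewrite -ltNge.
apply: (@le_lt_trans _ _ (E * W * (eta / W))).
  by apply: ler_wpM2l near; rewrite mulr_ge0 ?(ltW E0)// ltW.
have -> : E * W * (eta / W) = E * eta by field; rewrite gt_eqF.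
apply: (@le_lt_trans _ _ (E * (2 * E)^-1)).
  by rewrite ler_pM2l// ge_min lexx orbT.
by rewrite invfM mulrCA divff ?gt_eqF// mulr1 invf_lt1// ltr1n.
Qed.

End SeriesOfFractions.

(** * Passage to shifted sequences and conclusion *)

Theorem theorem4 (R : realType) (p C : nat) (eps kappa : R) (a b : nat -> int) :
  prime p -> (0 < C)%N -> 0 < eps -> 0 < kappa -> kappa < 1 ->
  (forall n, (0 < n)%N -> a n != 0 /\ b n != 0) ->
  (forall n, (0 < n)%N -> ~~ (p%:Z %| gcdz (a n) (b n))%Z) ->
  (forall M N : nat, exists2 n : nat, (N <= n)%N & (M <= nu p (a n))%N) ->
  (forall m n : nat, (0 < m)%N -> (0 < n)%N -> m <> n ->
     nu p (a m) <> nu p (a n) \/ (nu p (a m) = nu p (a n) /\ (nu p (a m) <= C)%N)) ->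
  (exists N : nat, forall n : nat, (N <= n)%N -> (0 < n)%N ->
     [/\ a n <= a n.+1,
         (n%:R : R) `^ (1 + eps) <= (a n)%:~R
       & `|(b n)%:~R| <= (2 : R) `^ ((log2 (`|(a n)%:~R| : R)) `^ kappa)]) ->
  ((forall (M : R) (N : nat), exists2 n : nat, (N <= n)%N &
       M < `|(a n)%:~R| `^ (2 ^+ n)^-1) ->
     p_irrational R p a b) /\
  ((forall A : nat, (0 < A)%N -> forall (M : R) (N : nat), exists2 n : nat, (N <= n)%N &
       M < (a n)%:~R `^ ((A%:R : R) ^+ n)^-1) ->
     p_transcendental R p a b).
Proof.
move=> p_pr _ eps0 k0 k1 ab0 pgcd nu_inf nu_dist [N0 HN].
(* Shifting past [N0] makes the eventual hypotheses hold at every index, now counted from 0. *)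
pose sh (u : nat -> int) i := u (i + N0).+1.
have HN' i : [/\ sh a i <= sh a i.+1, (i.+1%:R : R) `^ (1 + eps) <= (sh a i)%:~R
    & `|(sh b i)%:~R| <= (2 : R) `^ ((log2 ((sh a i)%:~R : R)) `^ kappa)].
  have [h1 h2 h3] := HN (i + N0).+1 (leqW (leq_addl _ _)) isT.
  have h4 : (i.+1%:R : R) `^ (1 + eps) <= (sh a i)%:~R.
    apply: le_trans h2; apply: ge0_ler_powR; rewrite ?nnegrE ?ler0n//.
      by rewrite addr_ge0// ltW.
    by rewrite ler_nat ltnS leq_addr.
  have a0 : 0 <= (sh a i)%:~R :> R by apply: le_trans h4; exact: powR_ge0.
  split; [exact: h1|exact: h4|].
  by move: h3; rewrite [`|(a _)%:~R|]ger0_norm.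
have b_ndiv i : (0 < nu p (sh a i))%N -> ~~ (p%:Z %| sh b i)%Z.
  have [a0 _] := ab0 (i + N0).+1 isT.
  rewrite /nu logn_gt0 mem_primes => /and3P[_ _ pa].
  apply: contra (pgcd (i + N0).+1 isT) => pb.
  by rewrite dvdz_gcd pb andbT dvdzE.
have nu_distinct i j : i <> j ->
    nu p (sh a i) <> nu p (sh a j) \/ (nu p (sh a i) <= C)%N.
  move=> ij; have [||[_ h]] := nu_dist (i + N0).+1 (j + N0).+1 isT isT;
    [|by left|by right].
  by move=> [] /eqP; rewrite eqn_add2r => /eqP.
have nu_unb M : exists n, (M <= nu p (sh a n))%N.
  have [n nN nM] := nu_inf M N0.+1; exists (n - N0.+1)%N.
  by rewrite /sh -addnS subnK.
have limsup D : (forall (M : R) (N : nat), exists2 n : nat, (N <= n)%N &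
      M < (a n)%:~R `^ (D.+1%:R ^+ n)^-1) ->
    forall (B : R) (N : nat), exists2 r, (N <= r)%N &
      B * D.+1%:R ^+ r < log2 (sh a r)%:~R.
  (* The shift lowers the exponent of D + 1, which weakens the bound only for a nonnegative factor;
     hence the maximum with 0. *)
  move=> H B N; have [n nN Hn] := H (2 `^ (Num.max 0 B)) (N + N0.+1)%N.
  have nN0 : (N0.+1 <= n)%N by apply: leq_trans nN; rewrite leq_addl.
  exists (n - N0.+1)%N; first by rewrite leq_subRL// addnC.
  have E : sh a (n - N0.+1)%N = a n by rewrite /sh -addnS subnK.
  have [_ h2 _] := HN' (n - N0.+1)%N.
  have an0 : 0 < (a n)%:~R :> R.
    by rewrite -E; apply: lt_le_trans h2; rewrite powR_gt0// ltr0n.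
  have A0 m : 0 < (D.+1%:R : R) ^+ m by rewrite exprn_gt0// ltr0n.
  rewrite E; apply: le_lt_trans (log2_gt_of_root _ _ _ _ an0 (A0 n) Hn).
  apply: (@le_trans _ _ (Num.max 0 B * D.+1%:R ^+ (n - N0.+1))).
    by rewrite ler_pM2r// le_max lexx orbT.
  apply: ler_wpM2l; first by rewrite le_max lexx.
  by rewrite ler_weXn2l ?ler1n// leq_subr.
have main (c : nat -> int) : (forall n, (0 < n)%N -> ~~ (p%:Z %| c n)%Z) ->
    cvgn (series (pterm (R := R) a b c)) /\
    forall D, (0 < D)%N ->
      (forall (M : R) (N : nat), exists2 n : nat, (N <= n)%N &
        M < (a n)%:~R `^ (D.+1%:R ^+ n)^-1) ->
      forall P : {poly rat}, P != 0 -> (size P <= D.+1)%N ->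
      ~~ root (map_poly ratr P) (limn (series (pterm (R := R) a b c))).
  move=> pc; have pc' i : ~~ (p%:Z %| sh c i)%Z by exact: pc.
  have h1 i := let: And3 h _ _ := HN' i in h.
  have h2 i := let: And3 _ h _ := HN' i in h.
  have h3 i := let: And3 _ _ h := HN' i in h.
  have cv := cvg_series_frac R p eps kappa (sh a) (sh b) (sh c) eps0 k1 h1 h2 h3 pc'.
  set x := pterm a b c; set x' := (fun i : nat => _) in cv.
  pose q0 : rat := \sum_(0 <= k < N0) ((b k.+1)%:~R / ((a k.+1)%:~R * (c k.+1)%:~R)).
  have q0E : ratr q0 = \sum_(0 <= k < N0) x k.
    rewrite rmorph_sum /=; apply: eq_bigr => j _.
    by rewrite fmorph_div /= rmorphM /= !ratr_int.
  have xE n : series x (n + N0)%N = ratr q0 + series x' n.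
    rewrite /series /= (@big_cat_nat _ _ _ N0)//= ?leq_addl// q0E; congr (_ + _).
    by rewrite -{1}[N0]add0n big_addn addnK.
  have lx : (series x @ \oo --> ratr q0 + limn (series x'))%classic.
    rewrite -(cvg_shiftn N0).
    under eq_fun do rewrite xE.
    by apply: cvgD => //; exact: cvg_cst.
  split; first by apply: cvgP lx.
  move=> D D0 HD P P0 sP.
  rewrite (cvg_lim (@Rhausdorff R) lx).
  (* The discarded terms have rational sum [q0]; translating [P] by it turns a root at the full sum
     into one at the shifted sum. *)
  have sP2 : size (P \Po ('X + q0%:P)) = size P by rewrite size_comp_poly2// size_XaddC.
  have := limit_not_root R p C eps kappa (sh a) (sh b) (sh c) p_pr eps0 k0 k1 h1 h2 h3
    b_ndiv nu_distinct nu_unb pc' D D0 (limsup D HD) (P \Po ('X + q0%:P)).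
  rewrite -size_poly_eq0 sP2 size_poly_eq0 => /(_ P0 sP).
  rewrite map_comp_poly /= rmorphD /= map_polyX map_polyC /=.
  by rewrite /root horner_comp !hornerE addrC.
split=> [H|H] c pc; have [cv nr] := main c pc; split=> //.
(* A rational limit [q] is a root of X - q, which the case D = 1 excludes. *)
- move=> [q Sq].
  have := nr 1%N isT _ ('X - q%:P).
  rewrite polyXsubC_eq0 size_XsubC => /(_ _ isT isT).
  rewrite rmorphB /= map_polyX map_polyC /= root_XsubC Sq eqxx.
  move=> /(_ _)/negP; apply=> // M N.
  have [n nN Hn] := H M (maxn N N0.+1); move: nN; rewrite geq_max => /andP[nN nN0].
  have [_ h2 _] := HN n (ltnW nN0) (leq_trans (ltn0Sn _) nN0).
  have a0 : 0 <= (a n)%:~R :> R by apply: le_trans h2; exact: powR_ge0.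
  by exists n => //; move: Hn; rewrite (ger0_norm a0).
(* Any positive D with size P <= D + 1 would do; the growth hypothesis is used with A = D + 1. *)
- move=> P P0; apply: (nr (size P).+1) => //; first by apply: H.
  by rewrite ltnW.
Qed.
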